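(* Let $0<p<\infty$ and let $m,n\ge1$ be integers. Then there does not exist any continuous map $\tau:\mathbb{R}^m\to\mathbb{R}^n$ such that the composition operator $C_\tau f=f\circ\tau$ is bounded from $L^{p}(\mathbb{R}^n)$ to $L^\infty(\mathbb{R}^m)$.
   Context: $\mathbb{R}^n,\mathbb{R}^m$ carry Lebesgue measure. Boundedness means $\|C_\tau f\|_{L^\infty(\mathbb{R}^m)}\le C\|f\|_{L^{p}(\mathbb{R}^n)}$ for some $C$ and all $f\in L^{p}(\mathbb{R}^n)$. *)

(* Defs.v *)
From HB Require Import structures.
From mathcomp Require Import all_boot all_order all_algebra.
From mathcomp Require Import all_classical all_reals all_analysis.

Set Implicit Arguments.
Unset Strict Implicit.
Unset Printing Implicit Defensive.

Import Order.TTheory GRing.Theory Num.Theory.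
Import numFieldNormedType.Exports.

Local Open Scope classical_set_scope.
Local Open Scope ring_scope.

(* the product of two sigma-finite measures is sigma-finite (the library
   proves this but its instance is shadowed by the subprobability one) *)
Section product_sigma_finite.
Local Open Scope ereal_scope.
Context d1 d2 (T1 : measurableType d1) (T2 : measurableType d2) (R : realType).
Variable m1 : {sigma_finite_measure set T1 -> \bar R}.
Variable m2 : {sigma_finite_measure set T2 -> \bar R}.

Lemma product_measure_sigma_finite' : sigma_finite setT (m1 \x m2).
Proof.
have /sigma_finiteP[F [TF ndF Foo]] := sigma_finiteT m1.
have /sigma_finiteP[G [TG ndG Goo]] := sigma_finiteT m2.
exists (fun n => F n `*` G n).
  rewrite -setXTT TF TG predeqE => -[x y]; split.
    move=> [/= [n _ Fnx] [k _ Gky]]; exists (maxn n k) => //; split.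
    - by move: x Fnx; exact/subsetPset/ndF/leq_maxl.
    - by move: y Gky; exact/subsetPset/ndG/leq_maxr.
  by move=> [n _ []/= ? ?]; split; exists n.
move=> k; have [? ?] := Foo k; have [? ?] := Goo k.
split; first exact: measurableX.
by rewrite product_measure1E// lte_mul_pinfty// ge0_fin_numE.
Qed.

Definition sf_product : {sigma_finite_measure set (T1 * T2)%type -> \bar R} :=
  HB.pack (m1 \x m2)
    (Measure_isSigmaFinite.Build _ _ _ (m1 \x m2) product_measure_sigma_finite').

End product_sigma_finite.

(* The carrier of this measure space is the
   iterated product R * (R * ( ... * unit)); it is identified with the row
   vectors 'rV[R]_n (which carry the Euclidean topology) by [to_rV]. *)
Section Euclidean.
Variable R : realType.

Fixpoint euc_space (n : nat) : {d : measure_display & measurableType d} :=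
  match n with
  | 0 => existT _ _ (Measurable.clone _ unit _)
  | k.+1 => existT _ _ (Measurable.clone _ (measurableTypeR R * projT2 (euc_space k))%type _)
  end.

Definition Rn (n : nat) : measurableType (projT1 (euc_space n)) :=
  projT2 (euc_space n).

Fixpoint leb (n : nat) : {sigma_finite_measure set Rn n -> \bar R} :=
  match n return {sigma_finite_measure set Rn n -> \bar R} with
  | 0 => @dirac _ unit tt R
  | k.+1 => sf_product (@lebesgue_measure R) (leb k)
  end.

Fixpoint to_rV (n : nat) : Rn n -> 'rV[R]_n :=
  match n return Rn n -> 'rV[R]_n with
  | 0 => fun _ => 0
  | k.+1 => fun x => row_mx (const_mx x.1 : 'rV[R]_1) (@to_rV k x.2)
  end.

Definition on_Rn (n : nat) (f : 'rV[R]_n -> R) : Rn n -> R := f \o @to_rV n.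

Definition in_Lp (n : nat) (p : R) (f : 'rV[R]_n -> R) : Prop :=
  measurable_fun setT (on_Rn f) /\
  (Lnorm (leb n) p%:E (EFin \o on_Rn f) < +oo)%E.

Definition Lp_norm (n : nat) (p : R) (f : 'rV[R]_n -> R) : \bar R :=
  Lnorm (leb n) p%:E (EFin \o on_Rn f).

Definition Linf_norm (n : nat) (f : 'rV[R]_n -> R) : \bar R :=
  Lnorm (leb n) +oo%E (EFin \o on_Rn f).

End Euclidean.

(* Main.v *)
(* Test the operator on indicators of small balls: in 'rV[R]_n a ball of
   radius r is a cube of volume (2r)^n, so its indicator has L^p norm
   (2r)^(n/p), which tends to 0 with r.  By continuity, the indicator of
   B(tau x, r) composed with tau equals 1 on a whole ball around x, which has
   positive measure, so its essential supremum is at least 1.  Hence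
   1 <= C (2r)^(n/p) for all r > 0, which fails for r small. *)

Require Import Defs.
From HB Require Import structures.
From mathcomp Require Import all_boot all_order all_algebra.
From mathcomp Require Import all_classical all_reals all_analysis.
From mathcomp Require Import ring lra ess_sup_inf measurable_realfun.

Set Implicit Arguments.
Unset Strict Implicit.
Unset Printing Implicit Defensive.

Import Order.TTheory GRing.Theory Num.Theory.
Import numFieldNormedType.Exports.

Local Open Scope classical_set_scope.
Local Open Scope ring_scope.

Section Lnorm_bounds.
Local Open Scope ereal_scope.
Context d (T : measurableType d) (R : realType).
Variable mu : {measure set T -> \bar R}.

Lemma Lnorm_indic (p : R) (A : set T) : measurable A -> p != 0%R ->
  Lnorm mu p%:E (EFin \o \1_A) = mu A `^ p^-1.
Proof.
move=> mA p0; rewrite unlock.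
have powR_norm_indic x : `|(EFin \o \1_A) x| `^ p = (\1_A x)%:E.
  by rewrite /= indicE; case: (_ \in _); rewrite /= ?normr1 ?powR1 ?normr0 ?powR0.
by under eq_integral => x _ do rewrite powR_norm_indic; rewrite integral_indic// setIT.
Qed.

Lemma Lnorm_infty_ge (f : T -> \bar R) (A : set T) (a : \bar R) :
  measurable A -> 0 < mu A -> (forall x, A x -> a <= `|f x|) ->
  a <= Lnorm mu +oo f.
Proof.
move=> mA muA0 afA; rewrite unlock ifT; last first.
  by apply: lt_le_trans muA0 _; apply: le_measure; rewrite ?inE.
rewrite leNgt; apply/negP => supa.
have [N [mN muN0 notleN]] := ess_supP (lexx (ess_sup mu (abse \o f))).
suff : mu A <= mu N by rewrite muN0 leNgt muA0.
apply: le_measure; rewrite ?inE// => x Ax; apply: notleN => /= fsup.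
by have := le_trans (afA x Ax) fsup; rewrite leNgt supa.
Qed.

End Lnorm_bounds.

Section Euclidean_balls.
Variable R : realType.

Lemma to_rV_ballS (k : nat) (y : 'rV[R]_k.+1) (r : R) : 0 < r ->
  @to_rV R k.+1 @^-1` ball y r =
  `]y 0 0 - r, y 0 0 + r[%classic `*`
    (@to_rV R k @^-1` ball (rsubmx (y : 'rV_(1 + k))) r).
Proof.
move=> r0; have ord0E : (0 : 'I_k.+1) = lshift k (0 : 'I_1) by apply/val_inj.
apply/seteqP; split => -[x1 x2] /=.
  move=> [_ x12y]; split.
    have := x12y 0 (lshift k (0 : 'I_1)); rewrite (@row_mxEl _ 1 1 k) mxE -ord0E.
    by rewrite /ball /= ltr_distlC in_itv.
  split => // i j; have := x12y i (rshift 1 j).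
  by rewrite (@row_mxEr _ 1 1 k) mxE.
move=> [x1y [_ x2y]]; split => // i j.
case: (@splitP 1 k j) => j' hj.
  have -> : j = lshift k j' :> 'I_(1 + k) by apply/val_inj.
  rewrite (@row_mxEl _ 1 1 k) mxE !ord1 /ball /= ltr_distlC -ord0E.
  by rewrite in_itv /= in x1y.
have -> : j = rshift 1 j' :> 'I_(1 + k) by apply/val_inj.
by rewrite (@row_mxEr _ 1 1 k); have := x2y i j'; rewrite mxE.
Qed.

Lemma to_rV0_ball (y : 'rV[R]_0) (r : R) : 0 < r ->
  @to_rV R 0 @^-1` ball y r = setT.
Proof. by move=> r0; apply/seteqP; split => // x _; split => // i []. Qed.

Lemma measurable_to_rV_ball (k : nat) (y : 'rV[R]_k) (r : R) : 0 < r ->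
  measurable (@to_rV R k @^-1` ball y r).
Proof.
move=> r0; elim: k y => [|k IH] y; first by rewrite to_rV0_ball.
by rewrite to_rV_ballS//; apply: measurableX.
Qed.

Lemma leb_to_rV_ball (k : nat) (y : 'rV[R]_k) (r : R) : 0 < r ->
  leb R k (@to_rV R k @^-1` ball y r) = ((2 * r) ^+ k)%:E.
Proof.
move=> r0; elim: k y => [|k IH] y; first by rewrite to_rV0_ball//= diracE in_setT.
rewrite to_rV_ballS//= product_measure1E ?IH//; last exact: measurable_to_rV_ball.
have := @lebesgue_measure_itv R `]y 0 0 - r, y 0 0 + r[.
rewrite /= lte_fin ltrD2l gt0_cp// => ->; rewrite -EFinD -EFinM exprS.
by congr (_%:E); ring.
Qed.

Lemma on_Rn_indic (n : nat) (B : set 'rV[R]_n) :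
  on_Rn (\1_B) = \1_(@to_rV R n @^-1` B).
Proof. by apply/funext => x; rewrite /on_Rn /= !indicE. Qed.

Lemma Lp_norm_indic_ball (n : nat) (p : R) (y : 'rV[R]_n) (r : R) :
  p != 0 -> 0 < r -> Lp_norm p (\1_(ball y r)) = (((2 * r) ^+ n) `^ p^-1)%:E.
Proof.
move=> p0 r0; rewrite /Lp_norm on_Rn_indic Lnorm_indic//.
  by rewrite -poweR_EFin; congr (_ `^ _)%E; exact: leb_to_rV_ball.
exact: measurable_to_rV_ball.
Qed.

Lemma in_Lp_indic_ball (n : nat) (p : R) (y : 'rV[R]_n) (r : R) :
  p != 0 -> 0 < r -> in_Lp p (\1_(ball y r)).
Proof.
move=> p0 r0; split; last by rewrite -/(Lp_norm _ _) Lp_norm_indic_ball// ltry.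
by rewrite on_Rn_indic; apply: measurable_indic; exact: measurable_to_rV_ball.
Qed.

Lemma Linf_norm_indic_ball_comp (m n : nat) (tau : 'rV[R]_m -> 'rV[R]_n)
    (x : 'rV[R]_m) (r : R) :
  {for x, continuous tau} -> 0 < r ->
  (1 <= Linf_norm (\1_(ball (tau x) r) \o tau))%E.
Proof.
move=> ctau r0.
have [d d0 dtau] : nbhs_ball x (tau @^-1` ball (tau x) r).
  by apply/nbhs_ballP; exact: ctau _ (nbhsx_ballx (tau x) r r0).
apply: (@Lnorm_infty_ge _ _ R (leb R m) _ (@to_rV R m @^-1` ball x d)).
- exact: measurable_to_rV_ball.
- rewrite [X in (_ < X)%E](_ : _ = ((2 * d) ^+ m)%:E); last exact: leb_to_rV_ball.
  by rewrite lte_fin exprn_gt0// mulr_gt0.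
- by move=> z /dtau tauz; rewrite /on_Rn /= indicE mem_set//= normr1.
Qed.

End Euclidean_balls.

Lemma exists_powR_exprn_le (R : realType) (p e : R) (n : nat) :
  0 < p -> (0 < n)%N -> 0 < e -> exists2 s : R, 0 < s & (s ^+ n) `^ p^-1 <= e.
Proof.
move=> p0 n0 e0; set s := Num.min 1 (e `^ p).
have s0 : 0 < s by rewrite lt_min ltr01 powR_gt0.
have s1 : s <= 1 by rewrite ge_min lexx.
have se : s <= e `^ p by rewrite ge_min lexx orbT.
exists s => //.
have sn : s ^+ n <= e `^ p.
  rewrite -(prednK n0) exprS (le_trans _ se)//.
  by apply: ler_piMr; [exact: ltW | exact: exprn_ile1 (ltW s0) s1].
rewrite -[e in _ <= e](@powRr1 _ e) ?(ltW e0)// -(mulfV (lt0r_neq0 p0)) powRrM.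
apply: ge0_ler_powR => //; rewrite ?nnegrE ?invr_ge0 ?powR_ge0 ?ltW//.
by rewrite exprn_gt0.
Qed.

Theorem proposition5p6 (R : realType) (p : R) (m n : nat) :
  0 < p -> (1 <= m)%N -> (1 <= n)%N ->
  ~ exists tau : 'rV[R]_m -> 'rV[R]_n,
      continuous tau /\
      exists C : R, forall f : 'rV[R]_n -> R, in_Lp p f ->
        (Linf_norm (f \o tau) <= C%:E * Lp_norm p f)%E.
Proof.
move=> p0 _ n0 [tau [ctau [C HC]]].
have e0 : 0 < (`|C| + 1)^-1 by rewrite invr_gt0 ltr_pwDr.
have [s s0 small] := exists_powR_exprn_le p0 n0 e0.
have r0 : 0 < s / 2 by rewrite divr_gt0.
have := le_trans (Linf_norm_indic_ball_comp (ctau 0) r0)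
  (HC _ (in_Lp_indic_ball (tau 0) (lt0r_neq0 p0) r0)).
rewrite (Lp_norm_indic_ball _ (lt0r_neq0 p0) r0) -EFinM lee_fin mulrCA divff// mulr1.
set y := (s ^+ n) `^ p^-1 in small *.
have y0 : 0 < y by rewrite powR_gt0// exprn_gt0.
have Cy : (`|C| + 1) * y <= 1 by rewrite -ler_pdivlMl ?mulr1// ltr_pwDr.
have := ler_norm C; clearbody y; nra.
Qed.
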